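(* Let $X$ be an infinite compact space which is simple and cleavable over an ordinal. Then $X$ is homeomorphic to an ordinal.
   Context: A space $X$ is cleavable over a space $Y$ if for every $A\subseteq X$ there is a continuous $f:X\to Y$ with $f(A)\cap f(X\setminus A)=\emptyset$. Ordinals carry the order topology. Derived sets: $X^0=X$, $X^{\alpha+1}=(X^\alpha)'$, $X^\lambda=\bigcap_{\alpha<\lambda}X^\alpha$ for limit $\lambda$. For a compact scattered space the Cantor–Bendixson rank $\mathrm{CB}(X)$ (least $\mu$ with $X^\mu=\emptyset$) is a successor $\beta+1$ and $X^\beta$ is finite; $X$ is called simple (with $\hat x$) if $X^\beta=\{\hat x\}$ is a single point. *)

(* Defs.v *)
From Stdlib Require Import List Classical.



Record Top := {
  pt :> Type;
  is_open : (pt -> Prop) -> Prop;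
  open_full : is_open (fun _ => True);
  open_inter : forall U V, is_open U -> is_open V -> is_open (fun x => U x /\ V x);
  open_union : forall F : (pt -> Prop) -> Prop,
      (forall U, F U -> is_open U) -> is_open (fun x => exists U, F U /\ U x)
}.

(** Ordinals, represented (up to order isomorphism) by well-ordered types. *)
Record WellOrder := {
  wo_car :> Type;
  wo_lt : wo_car -> wo_car -> Prop;
  wo_irrefl : forall x, ~ wo_lt x x;
  wo_trans : forall x y z, wo_lt x y -> wo_lt y z -> wo_lt x z;
  wo_total : forall x y, wo_lt x y \/ x = y \/ wo_lt y x;
  wo_wf : well_founded wo_lt
}.

Definition above (W : WellOrder) (l : option W) (x : W) : Prop :=
  match l with None => True | Some a => @wo_lt W a x end.
Definition below (W : WellOrder) (u : option W) (x : W) : Prop :=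
  match u with None => True | Some b => @wo_lt W x b end.

Definition order_open (W : WellOrder) (U : W -> Prop) : Prop :=
  forall x, U x -> exists l u : option W,
    above W l x /\ below W u x /\ (forall y, above W l y -> below W u y -> U y).

Definition cont_to_ord (X : Top) (W : WellOrder) (f : X -> W) : Prop :=
  forall V : W -> Prop, order_open W V -> is_open X (fun x => V (f x)).
Definition cont_from_ord (W : WellOrder) (X : Top) (g : W -> X) : Prop :=
  forall U : X -> Prop, is_open X U -> order_open W (fun w => U (g w)).

Definition cleavable_over (X : Top) (W : WellOrder) : Prop :=
  forall A : X -> Prop, exists f : X -> W, cont_to_ord X W f /\
    (forall a b : X, A a -> ~ A b -> f a <> f b).

Definition cleavable_over_ordinal (X : Top) : Prop :=
  exists W : WellOrder, cleavable_over X W.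

Definition homeomorphic_to_ordinal (X : Top) : Prop :=
  exists (W : WellOrder) (f : X -> W) (g : W -> X),
    cont_to_ord X W f /\ cont_from_ord W X g /\
    (forall x, g (f x) = x) /\ (forall w, f (g w) = w).

Definition compact (X : Top) : Prop :=
  forall F : (X -> Prop) -> Prop,
    (forall U, F U -> is_open X U) ->
    (forall x, exists U, F U /\ U x) ->
    exists l : list (X -> Prop), (forall U, In U l -> F U) /\
      (forall x, exists U, In U l /\ U x).

Definition infinite_space (X : Top) : Prop :=
  forall l : list (pt X), exists x, ~ In x l.

Definition derived (X : Top) (S : X -> Prop) : X -> Prop :=
  fun x => S x /\ forall U, is_open X U -> U x -> exists y, y <> x /\ U y /\ S y.

Definition is_pred (W : WellOrder) (b a : W) : Prop :=
  @wo_lt W b a /\ forall c, @wo_lt W b c -> ~ @wo_lt W c a.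

(** Iterated derived sets X^a indexed by a well-order, by well-founded recursion:
    X^0 = X, X^(b+1) = (X^b)', X^a = intersection of X^b (b < a) for limit a. *)
Definition deriv_iter (X : Top) (W : WellOrder) : W -> X -> Prop :=
  Fix (wo_wf W) (fun _ => X -> Prop)
    (fun a rec x =>
       (forall b (h : @wo_lt W b a), is_pred W b a -> derived X (rec b h) x) /\
       ((~ exists b, is_pred W b a) -> forall b (h : @wo_lt W b a), rec b h x)).

Definition CB_rank_is (X : Top) (W : WellOrder) (m : W) : Prop :=
  (forall x, ~ deriv_iter X W m x) /\
  (forall n, @wo_lt W n m -> exists x, deriv_iter X W n x).

Definition simple (X : Top) : Prop :=
  exists (W : WellOrder) (b m : W) (xh : X),
    is_pred W b m /\ CB_rank_is X W m /\
    (forall x, deriv_iter X W b x <-> x = xh).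

(* Main.v *)
From Stdlib Require Import List Classical ClassicalEpsilon FunctionalExtensionality PropExtensionality Lia.
Require Import Defs.

(** By scatteredness it is enough to show that if every point near [x], other
    than [x], has a clopen neighbourhood carrying a well-order compatible with
    the topology, then so does [x]. Compatible well-orders can be glued
    lexicographically along a continuous map [g] to a well-order all of whose
    fibres are clopen or single points, so one wants such a [g] with [x] alone
    in the top fibre.

    Start from a map [f] cleaving [{x}], with [f x] as largest value. If [f x]
    has countable cofinality, cut along a cofinal sequence. Otherwise call a
    height [c] good if adding at most one point to [{f < c}] makes it clopen; a
    closed unbounded set of good heights gives [g]. If there is none, pick for
    each bad [c] a point [q_c] of height [c] in the closure of [{f < c}] and let
    [k] cleave the complement of [x] and all the [q_c]. Comparing the heights
    given by [f] and [k] along a closed unbounded set shows that the fibre of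
    [k] through [x], which consists of points [q_c], is unbounded in height: it
    is a closed thread converging to [x]. Cleave again, now splitting the thread
    into its limit and non-limit points. The same comparison makes the fibre
    through [x] of the new map unbounded among the limit points, and interleaving
    it with non-limit points forces two different values at a common limit. *)

Notation "a << b" := (wo_lt _ a b) (at level 70, no associativity).

(** * Choice principles *)

Lemma choice_fun {A B : Type} (R : A -> B -> Prop) :
  (forall a, exists b, R a b) -> exists f : A -> B, forall a, R a (f a).
Proof.
  intros H.
  exists (fun a => proj1_sig (constructive_indefinite_description _ (H a))).
  intros a; apply (proj2_sig (constructive_indefinite_description _ (H a))).
Qed.

Lemma dependent_choice {A : Type} (P : A -> Prop) (R : A -> A -> Prop) (a0 : A) :
  P a0 -> (forall a, P a -> exists b, P b /\ R a b) ->
  exists s : nat -> A, s 0 = a0 /\ forall n, P (s n) /\ R (s n) (s (S n)).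
Proof.
  intros Ha0 H.
  destruct (choice_fun (fun a b => P a -> P b /\ R a b)) as [step Hstep].
  { intros a. destruct (classic (P a)) as [Pa|nPa].
    - destruct (H a Pa) as [b Hb]; exists b; auto.
    - exists a; tauto. }
  pose (s := fix s n := match n with 0 => a0 | S n => step (s n) end).
  assert (HP : forall n, P (s n)).
  { induction n; simpl; auto. apply Hstep; auto. }
  exists s; split; [reflexivity|]. intros n; split; auto. apply Hstep; auto.
Qed.

(** * Well-orders *)

Lemma wo_least (W : WellOrder) (P : W -> Prop) :
  (exists w, P w) -> exists m, P m /\ forall w, P w -> ~ w << m.
Proof.
  intros [w Pw]. apply NNPP; intros Hn.
  enough (H : forall v, ~ P v) by exact (H w Pw).
  intros v. induction v as [v IH] using (well_founded_ind (wo_wf W)).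
  intros Pv. apply Hn. exists v. split; auto.
  intros u Pu Hu. exact (IH u Hu Pu).
Qed.

Lemma wo_lt_le_trans (W : WellOrder) (a b c : W) : a << b -> ~ c << b -> a << c.
Proof.
  intros Hab Hcb. destruct (wo_total W b c) as [H|[H|H]].
  - exact (wo_trans W _ _ _ Hab H).
  - congruence.
  - contradiction.
Qed.

Lemma wo_eq_le (W : WellOrder) (a b : W) : a = b -> ~ a << b /\ ~ b << a.
Proof. intros ->; split; apply wo_irrefl. Qed.

Ltac wo_fact P p := match goal with _ : P |- _ => fail 1 | _ => assert P by exact p end.

(* Decides goals in the theory of linear orders: any inconsistency contains a
   cycle through a strict inequality, found by closing [<<] under composition
   with [<<] and with the weak order [fun a b => ~ b << a]. *)
Ltac worder_close :=
  match goal with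
  | H : wo_lt _ ?a ?a |- _ => exfalso; exact (wo_irrefl _ _ H)
  | H : wo_lt ?W ?a ?b, N : ~ wo_lt ?W ?a ?b |- _ => exfalso; exact (N H)
  | N : ?a <> ?a |- _ => exfalso; exact (N eq_refl)
  | H : @eq (wo_car ?W) ?a ?b |- _ =>
      pose proof (wo_eq_le W a b H) as [? ?]; clear H; worder_close
  | H : wo_lt ?W ?a ?b, K : wo_lt ?W ?b ?c |- _ =>
      wo_fact (wo_lt W a c) (wo_trans W a b c H K); worder_close
  | H : wo_lt ?W ?a ?b, K : ~ wo_lt ?W ?c ?b |- _ =>
      wo_fact (wo_lt W a c) (wo_lt_le_trans W a b c H K); worder_close
  | N : ~ @eq (wo_car ?W) ?a ?b |- _ =>
      destruct (wo_total W a b) as [?|[?|?]]; [|contradiction|]; clear N; worder_close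
  end.

Ltac worder :=
  intros;
  lazymatch goal with
  | |- ~ _ => intro; worder_close
  | |- wo_lt _ _ _ => apply NNPP; intro; worder_close
  | |- @eq (wo_car _) _ _ => apply NNPP; intro; worder_close
  | |- _ => exfalso; worder_close
  end.

Lemma wo_max (W : WellOrder) (a b : W) : exists m, ~ m << a /\ ~ m << b /\ (m = a \/ m = b).
Proof.
  destruct (classic (a << b)).
  - exists b; repeat split; auto; worder.
  - exists a; repeat split; auto; worder.
Qed.

(** * Topology *)

Lemma open_ext (X : Top) (U V : X -> Prop) :
  (forall x, U x <-> V x) -> is_open X U -> is_open X V.
Proof.
  intros H HU. replace V with U; auto.
  apply functional_extensionality; intros x. apply propositional_extensionality, H.
Qed.

Lemma open_local (X : Top) (S : X -> Prop) :
  (forall x, S x -> exists U, is_open X U /\ U x /\ forall y, U y -> S y) -> is_open X S.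
Proof.
  intros H.
  apply (open_ext X (fun x => exists U, (is_open X U /\ forall y, U y -> S y) /\ U x)).
  - intros x; split.
    + intros [U [[_ HU] Ux]]; auto.
    + intros Sx; destruct (H x Sx) as [U [oU [Ux HU]]]; exists U; auto.
  - apply open_union. intros U [oU _]; exact oU.
Qed.

Lemma open_empty (X : Top) : is_open X (fun _ => False).
Proof. apply open_local; tauto. Qed.

Lemma open_or (X : Top) (U V : X -> Prop) :
  is_open X U -> is_open X V -> is_open X (fun x => U x \/ V x).
Proof. intros oU oV. apply open_local. intros x [Ux|Vx]; eauto 6. Qed.

Lemma open_const_or (X : Top) (P : Prop) (U : X -> Prop) :
  is_open X U -> is_open X (fun x => P \/ U x).
Proof.
  intros oU. apply open_or; auto. apply open_local.
  intros x HP. exists (fun _ => True); auto using open_full.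
Qed.

Definition clopen (X : Top) (S : X -> Prop) : Prop :=
  is_open X S /\ is_open X (fun x => ~ S x).

Lemma clopen_or (X : Top) (S T : X -> Prop) :
  clopen X S -> clopen X T -> clopen X (fun x => S x \/ T x).
Proof.
  intros [oS cS] [oT cT]. split; [apply open_or; auto|].
  eapply open_ext; [|apply (open_inter X _ _ cS cT)]. intros x; simpl; tauto.
Qed.

(** Directedness absorbs a finite subcover into one member, so later compactness arguments need no
    lists. *)
Lemma compact_directed (X : Top) (F : (X -> Prop) -> Prop) :
  compact X -> (forall U, F U -> is_open X U) -> (exists U, F U) ->
  (forall U V, F U -> F V -> exists T, F T /\ (forall x, U x \/ V x -> T x)) ->
  (forall x, exists U, F U /\ U x) -> exists U, F U /\ forall x, U x.
Proof.
  intros cX oF [U0 FU0] dF covF.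
  destruct (cX F oF covF) as [l [lF lcov]].
  assert (H : exists T, F T /\ forall U, In U l -> forall x, U x -> T x).
  { clear lcov. induction l as [|U l IH].
    - exists U0; simpl; tauto.
    - destruct IH as [T [FT HT]]; [intros V HV; apply lF; right; auto|].
      destruct (dF U T) as [T' [FT' HT']]; auto; [apply lF; left; auto|].
      exists T'; split; auto. intros V [->|HV] x Vx; apply HT'; eauto. }
  destruct H as [T [FT HT]]. exists T; split; auto.
  intros x. destruct (lcov x) as [U [HU Ux]]; eauto.
Qed.

(** * Continuous maps to well-orders *)

Definition ray_continuous (X : Top) (W : WellOrder) (f : X -> W) : Prop :=
  forall a, is_open X (fun y => f y << a) /\ is_open X (fun y => a << f y).

Lemma continuous_ray_continuous (X : Top) (W : WellOrder) (f : X -> W) :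
  cont_to_ord X W f -> ray_continuous X W f.
Proof.
  intros cf a; split.
  - apply (cf (fun w => w << a)). intros w Hw. exists None, (Some a); simpl; auto.
  - apply (cf (fun w => a << w)). intros w Hw. exists (Some a), None; simpl; auto.
Qed.

Lemma wo_succ (W : WellOrder) (a : W) :
  (exists b, forall w, ~ a << w <-> w << b) \/ (forall w, ~ a << w).
Proof.
  destruct (classic (exists b, a << b)) as [H|H].
  - destruct (wo_least W _ H) as [b [Hb Hl]]. left; exists b; intros w; split.
    + worder.
    + intros Hw Haw. exact (Hl w Haw Hw).
  - right; intros w Hw; eauto.
Qed.

(** A closed initial segment of a well-order is either everything or the open ray below the
    successor of its endpoint. *)
Lemma ray_continuous_le (X : Top) (W : WellOrder) (f : X -> W) (a : W) :
  ray_continuous X W f -> is_open X (fun y => ~ a << f y).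
Proof.
  intros cf. destruct (wo_succ W a) as [[b Hb]|H].
  - eapply open_ext; [|apply (proj1 (cf b))]. intros x; simpl. rewrite Hb; tauto.
  - eapply open_ext; [|apply open_full]. intros x; simpl; split; auto.
Qed.

Lemma clopen_upper_ray (X : Top) (W : WellOrder) (f : X -> W) (a : W) :
  ray_continuous X W f -> clopen X (fun y => a << f y).
Proof. split; [apply H | apply ray_continuous_le; auto]. Qed.

(** The sets where [f] is at most [d], for [d << l], are open by [ray_continuous_le] and nested, so
    the union of one of them with the complement of [K] is all of [X]. The last hypothesis supplies
    a bound when [K] is empty. *)
Lemma compact_bounded (X : Top) (W : WellOrder) (f : X -> W) (K : X -> Prop) (l : W) :
  compact X -> ray_continuous X W f -> is_open X (fun y => ~ K y) ->
  (forall y, K y -> f y << l) -> (exists d, d << l) ->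
  exists d, d << l /\ forall y, K y -> ~ d << f y.
Proof.
  intros cX cf cK Kl [d0 Hd0].
  destruct (compact_directed X
    (fun U => exists d, d << l /\ U = fun y => ~ K y \/ ~ d << f y)) as [U [[d [Hd ->]] H]]; auto.
  - intros U [d [_ ->]]. apply open_or; auto using ray_continuous_le.
  - exists (fun y => ~ K y \/ ~ d0 << f y), d0; auto.
  - intros U V [d [Hd ->]] [e [He ->]].
    destruct (wo_max W d e) as [m [Hm1 [Hm2 Hm]]].
    exists (fun y => ~ K y \/ ~ m << f y); split.
    + exists m; split; auto. destruct Hm; subst; auto.
    + intros x [[H|H]|[H|H]]; auto; right; worder.
  - intros x. destruct (classic (K x)) as [Kx|nKx].
    + exists (fun y => ~ K y \/ ~ f x << f y); split; [exists (f x); auto|right; worder].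
    + exists (fun y => ~ K y \/ ~ d0 << f y); split; [exists d0; auto|auto].
  - exists d; split; auto. intros y Ky. destruct (H y); tauto.
Qed.

(** * Subsets carrying a compatible well-order *)

(* Openness of the rays suffices as compatibility: on a compact space, a
   topology finer than the (Hausdorff) order topology equals it. *)
Definition well_orders (X : Top) (S : X -> Prop) (R : X -> X -> Prop) : Prop :=
  (forall a b, S a -> S b -> R a b -> ~ R b a) /\
  (forall P : X -> Prop, (exists x, S x /\ P x) ->
     exists m, S m /\ P m /\ forall y, S y -> P y -> y <> m -> R m y) /\
  (forall a, S a -> is_open X (fun y => S y /\ R y a) /\ is_open X (fun y => S y /\ R a y)).

Definition well_orderable (X : Top) (S : X -> Prop) : Prop := exists R, well_orders X S R.

(** The rays are empty, so the set need not be open; this admits single-point fibres at limit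
    levels. *)
Lemma well_orderable_subsingleton (X : Top) (S : X -> Prop) :
  (forall a b, S a -> S b -> a = b) -> well_orderable X S.
Proof.
  intros H. exists (fun _ _ => False). split; [tauto|split].
  - intros P [x [Sx Px]]. exists x; auto 6.
  - intros a _; split; (eapply open_ext; [|apply open_empty]); intros x; simpl; tauto.
Qed.

Lemma well_orderable_open_subset (X : Top) (S T : X -> Prop) :
  is_open X T -> (forall x, T x -> S x) -> well_orderable X S -> well_orderable X T.
Proof.
  intros oT TS [R [Ra [Rm Ro]]]. exists R. split; [|split].
  - auto.
  - intros P [x [Tx Px]].
    destruct (Rm (fun y => T y /\ P y)) as [m [Sm [[Tm Pm] Hm]]]; [exists x; auto|].
    exists m; repeat split; auto.
  - intros a Ta. destruct (Ro a (TS a Ta)) as [o1 o2].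
    split.
    + eapply open_ext; [|apply (open_inter X _ _ oT o1)]. intros x; simpl; firstorder.
    + eapply open_ext; [|apply (open_inter X _ _ oT o2)]. intros x; simpl; firstorder.
Qed.

Lemma well_orderable_union (X : Top) (S T : X -> Prop) :
  clopen X S -> clopen X T -> well_orderable X S -> well_orderable X T ->
  well_orderable X (fun x => S x \/ T x).
Proof.
  intros [oS cS] [oT cT] [R [Ra [Rm Ro]]] [Q [Qa [Qm Qo]]].
  exists (fun a b => (S a /\ S b /\ R a b) \/ (S a /\ ~ S b) \/ (~ S a /\ ~ S b /\ Q a b)).
  split; [|split].
  - intros a b [Ha|Ha] [Hb|Hb] H1 H2; specialize (Ra a b); specialize (Qa a b); tauto.
  - intros P [x [STx Px]].
    destruct (classic (exists y, S y /\ P y)) as [H|H].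
    + destruct (Rm P H) as [m [Sm [Pm Hm]]]. exists m; repeat split; auto.
      intros y _ Py n. destruct (classic (S y)); auto.
    + destruct (Qm P) as [m [Tm [Pm Hm]]].
      { exists x; split; auto. destruct STx; auto. exfalso; eauto. }
      exists m; repeat split; auto.
      intros y Sy Py n. right; right. destruct Sy as [Sy|Ty]; [exfalso; eauto|].
      repeat split; eauto.
  - intros a Ha. destruct (classic (S a)) as [Sa|nSa].
    + destruct (Ro a Sa) as [o1 o2]. split.
      * eapply open_ext; [|apply o1]. intros x; simpl; tauto.
      * eapply open_ext; [|apply (open_or X _ _ o2 (open_inter X _ _ cS oT))].
        intros x; simpl; tauto.
    + destruct Ha as [Sa|Ta]; [contradiction|]. destruct (Qo a Ta) as [o1 o2]. split.
      * eapply open_ext; [|apply (open_or X _ _ oS (open_inter X _ _ cS o1))].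
        intros x; simpl; destruct (classic (S x)); tauto.
      * eapply open_ext; [|apply (open_inter X _ _ cS o2)]. intros x; simpl; tauto.
Qed.

Lemma well_orderable_lexicographic (X : Top) (W : WellOrder) (g : X -> W) (S : X -> Prop) :
  is_open X S -> ray_continuous X W g ->
  (forall w, well_orderable X (fun y => S y /\ g y = w)) -> well_orderable X S.
Proof.
  intros oS cg H.
  destruct (choice_fun (fun w R => well_orders X (fun y => S y /\ g y = w) R) H) as [R HR].
  exists (fun a b => g a << g b \/ (g a = g b /\ R (g a) a b)). split; [|split].
  - intros a b Sa Sb [H1|[H1 H1']] [H2|[H2 H2']]; try (worder; fail).
    rewrite <- H1 in H2'. apply (proj1 (HR (g a)) a b); auto.
  - intros P [x [Sx Px]].
    destruct (wo_least W (fun w => exists y, S y /\ P y /\ g y = w)) as [w [[y [Sy [Py Hy]]] Hw]].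
    { exists (g x), x; auto. }
    destruct (proj1 (proj2 (HR w)) P) as [m [[Sm gm] [Pm Hm]]]; [exists y; auto|].
    exists m; repeat split; auto. intros z Sz Pz n.
    destruct (classic (g z = w)) as [e|ne].
    + right. rewrite e, gm. auto.
    + left. assert (~ g z << w) by (apply Hw; eauto). worder.
  - intros a Sa. destruct (proj2 (proj2 (HR (g a))) a) as [o1 o2]; auto. split.
    + eapply open_ext; [|apply (open_or X _ _ (open_inter X _ _ oS (proj1 (cg (g a)))) o1)].
      intros x; simpl. split.
      * intros [H1|[[H1 H2] H3]]; [tauto|]. split; auto. right. split; auto. rewrite H2; auto.
      * intros [H1 [H2|[H2 H3]]]; [tauto|]. right. rewrite H2 in H3. auto.
    + eapply open_ext; [|apply (open_or X _ _ (open_inter X _ _ oS (proj2 (cg (g a)))) o2)].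
      intros x; simpl. split.
      * intros [H1|[[H1 H2] H3]]; [tauto|]. split; auto.
      * intros [H1 [H2|[H2 H3]]]; [tauto|]. right. auto.
Qed.

Lemma well_orderable_homeomorphic (X : Top) :
  compact X -> well_orderable X (fun _ => True) -> homeomorphic_to_ordinal X.
Proof.
  intros cX [R [Ra [Rm Ro]]].
  assert (asym : forall a b, R a b -> ~ R b a) by auto.
  assert (irr : forall a, ~ R a a) by (intros a H; exact (asym a a H H)).
  (* Totality and transitivity come from minima of sets of two and three points. *)
  assert (tot : forall a b, R a b \/ a = b \/ R b a).
  { intros a b. destruct (Rm (fun y => y = a \/ y = b)) as [m [_ [Hm Hmin]]]; [eauto|].
    destruct (classic (a = b)); auto.
    destruct Hm; subst m; [left|right; right]; apply Hmin; auto. }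
  assert (tr : forall a b c, R a b -> R b c -> R a c).
  { intros a b c Hab Hbc. destruct (tot a c) as [H|[->|H]]; auto.
    - exfalso; exact (asym _ _ Hab Hbc).
    - exfalso. destruct (Rm (fun y => y = a \/ y = b \/ y = c)) as [m [_ [Hm Hmin]]]; [eauto|].
      assert (Hmin' : forall y, y = a \/ y = b \/ y = c -> ~ R y m).
      { intros y Hy HR. destruct (classic (y = m)) as [->|n]; [exact (irr _ HR)|].
        exact (asym _ _ HR (Hmin y I Hy n)). }
      destruct Hm as [->|[->| ->]].
      + exact (Hmin' c (or_intror (or_intror eq_refl)) H).
      + exact (Hmin' a (or_introl eq_refl) Hab).
      + exact (Hmin' b (or_intror (or_introl eq_refl)) Hbc). }
  assert (wf : well_founded R).
  { intros a. apply NNPP; intros Ha.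
    destruct (Rm (fun y => ~ Acc R y)) as [m [_ [Hm Hmin]]]; [eauto|].
    apply Hm. constructor. intros y Hy. apply NNPP; intros Hy'.
    destruct (classic (y = m)) as [->|n]; [exact (irr _ Hy)|].
    exact (asym _ _ Hy (Hmin y I Hy' n)). }
  pose (W := Build_WellOrder X R irr tr tot wf).
  pose (i := (fun x => x) : X -> W).
  assert (ci : ray_continuous X W i).
  { intros a. destruct (Ro a I) as [o1 o2].
    split; [apply (open_ext X _ _) with (2 := o1)|apply (open_ext X _ _) with (2 := o2)];
      intros x; unfold i, W; simpl; tauto. }
  exists W, i, (fun x => x). repeat split.
  - intros V oV. apply open_local. intros x Vx.
    destruct (oV x Vx) as [l [u [Hl [Hu H]]]].
    exists (fun y => above W l y /\ below W u y). repeat split; auto.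
    + apply open_inter.
      * destruct l as [a|]; simpl; [exact (proj2 (ci a))|apply open_full].
      * destruct u as [a|]; simpl; [exact (proj1 (ci a))|apply open_full].
    + intros y [H1 H2]; exact (H y H1 H2).
  - intros U oU x Ux.
    (* Only the left end of the interval needs compactness: the points outside [U] and at most [x]
       form a closed set strictly below [x]. On the right, the successor of [x], if there is one,
       serves as bound. *)
    assert (Hl : exists l, above W l x /\ forall y : W, above W l y -> ~ wo_lt W x y -> U y).
    { destruct (classic (exists d, wo_lt W d x)) as [Hd|Hd].
      - destruct (compact_bounded X W i (fun y => ~ U y /\ ~ wo_lt W x y) x) as [d [Hdx H]]; auto.
        + apply (open_ext X (fun y => U y \/ wo_lt W x (i y))).
          * intros y. unfold i. destruct (classic (U y)), (classic (wo_lt W x y)); tauto.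
          * apply open_or; auto. apply ci.
        + intros y [nU Hy]. unfold i. destruct (wo_total W y x) as [h|[h|h]]; auto.
          * subst; contradiction.
          * contradiction.
        + exists (Some d). split; auto. intros y Hy Hxy. apply NNPP; intros nU.
          exact (H y (conj nU Hxy) Hy).
      - exists None. split; [exact I|]. intros y _ Hy.
        destruct (wo_total W x y) as [h|[h|h]]; [contradiction|subst; auto|].
        exfalso; eauto. }
    destruct Hl as [l [Hlx Hl]]. exists l.
    destruct (wo_succ W x) as [[b Hb]|Hb].
    + exists (Some b). repeat split; auto.
      * apply Hb, (wo_irrefl W).
      * intros y Hy Hyb. apply Hl; auto. apply Hb; auto.
    + exists None. repeat split; auto.
Qed.

(** * Scatteredness *)

Lemma deriv_iter_unfold (X : Top) (W : WellOrder) (a : W) :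
  deriv_iter X W a = fun x =>
    (forall b, b << a -> is_pred W b a -> derived X (deriv_iter X W b) x) /\
    ((~ exists b, is_pred W b a) -> forall b, b << a -> deriv_iter X W b x).
Proof.
  unfold deriv_iter at 1. rewrite Fix_eq; [reflexivity|].
  intros c F G H. replace G with F; [reflexivity|].
  apply functional_extensionality_dep; intros b.
  apply functional_extensionality_dep; intros h. apply H.
Qed.

(** At the least stage losing a point of [B], all of [B] survives the earlier stages. Nothing is
    lost at limits, so that point is isolated in the preceding derived set, hence in [B]. *)
Lemma simple_scattered (X : Top) (B : X -> Prop) :
  simple X -> (exists z, B z) ->
  exists x, B x /\ exists U, is_open X U /\ U x /\ forall y, U y -> B y -> y = x.
Proof.
  intros [W [b [m [xh [_ [[Hm _] _]]]]]] [z Bz].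
  destruct (wo_least W (fun a => exists z, B z /\ ~ deriv_iter X W a z)) as [a [[x [Bx Hx]] Ha]].
  { exists m, z; auto. }
  assert (HB : forall c, c << a -> forall y, B y -> deriv_iter X W c y).
  { intros c Hc y By. apply NNPP; intros n. apply (Ha c); eauto. }
  rewrite deriv_iter_unfold in Hx.
  destruct (classic (exists c, is_pred W c a /\ ~ derived X (deriv_iter X W c) x))
    as [[c [Hc Hnd]]|Hn].
  - exists x; split; auto. apply NNPP; intros HU. apply Hnd. split.
    + apply HB; auto. apply Hc.
    + intros U oU Ux. apply NNPP; intros Hy. apply HU. exists U; repeat split; auto.
      intros y Uy By. apply NNPP; intros n. apply Hy. exists y; repeat split; auto.
      apply HB; auto. apply Hc.
  - exfalso. apply Hx. split.
    + intros c _ Hc. apply NNPP; intros n. eauto.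
    + intros _ c Hc. auto.
Qed.

Definition locally_well_orderable (X : Top) (x : X) : Prop :=
  exists T, clopen X T /\ T x /\ well_orderable X T.

(** Clopen well-orderable sets are closed under binary unions, so by compactness one of them covers
    [K]; adjoining the complement of [K] makes the cover one of [X]. *)
Lemma clopen_well_orderable (X : Top) (K : X -> Prop) :
  compact X -> clopen X K -> (forall y, K y -> locally_well_orderable X y) ->
  well_orderable X K.
Proof.
  intros cX [oK cK] HK.
  destruct (compact_directed X (fun U => exists T, clopen X T /\ well_orderable X T /\
    U = fun x => ~ K x \/ T x)) as [U [[T [cT [HT ->]]] H]]; auto.
  - intros U [T [[oT _] [_ ->]]]. apply open_or; auto.
  - exists (fun x => ~ K x \/ False), (fun _ => False). repeat split.
    + apply open_empty.
    + eapply open_ext; [|apply open_full]. simpl; tauto.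
    + apply well_orderable_subsingleton; tauto.
  - intros U V [S [cS [HS ->]]] [T [cT [HT ->]]].
    exists (fun x => ~ K x \/ (S x \/ T x)). split; [|tauto].
    exists (fun x => S x \/ T x). auto using clopen_or, well_orderable_union.
  - intros x. destruct (classic (K x)) as [Kx|nKx].
    + destruct (HK x Kx) as [T [cT [Tx HT]]]. exists (fun x => ~ K x \/ T x). eauto 6.
    + exists (fun x => ~ K x \/ False). split; auto. exists (fun _ => False). repeat split.
      * apply open_empty.
      * eapply open_ext; [|apply open_full]. simpl; tauto.
      * apply well_orderable_subsingleton; tauto.
  - apply (well_orderable_open_subset X T K); auto. intros x Kx; destruct (H x); tauto.
Qed.

(** * Layerings at a point *)

Definition layering (X : Top) (x : X) (W : WellOrder) (g : X -> W) : Prop :=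
  ray_continuous X W g /\ (forall y, y <> x -> g y << g x) /\
  forall w, w <> g x -> is_open X (fun y => g y = w) \/ (forall a b, g a = w -> g b = w -> a = b).

Lemma ray_neighbourhood (X : Top) (x : X) (W : WellOrder) (g : X -> W) (U : X -> Prop) :
  compact X -> ray_continuous X W g -> (forall y, y <> x -> g y << g x) -> (exists d, d << g x) ->
  is_open X U -> U x -> exists d, d << g x /\ forall y, d << g y -> U y.
Proof.
  intros cX cg gx Hd oU Ux.
  destruct (compact_bounded X W g (fun y => ~ U y) (g x)) as [d [Hdx H]]; auto.
  - eapply open_ext; [|exact oU]. intros y; simpl. split; [auto|apply NNPP].
  - intros y Uy. apply gx. intros ->; auto.
  - exists d; split; auto. intros y Hy. apply NNPP; intros n. exact (H y n Hy).
Qed.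

(** Some upper ray of [g] lies inside [U]. Its open fibres are clopen sets of locally well-orderable
    points, hence well-orderable; the others have at most one point, and lexicographic gluing
    applies. *)
Lemma layering_locally_well_orderable (X : Top) (x : X) (W : WellOrder) (g : X -> W)
    (U : X -> Prop) :
  compact X -> layering X x W g -> (exists d, d << g x) -> is_open X U -> U x ->
  (forall y, U y -> y <> x -> locally_well_orderable X y) -> locally_well_orderable X x.
Proof.
  intros cX [cg [gx fib]] Hd oU Ux HU.
  destruct (ray_neighbourhood X x W g U) as [d [Hdx H]]; auto.
  exists (fun y => d << g y). split; [apply clopen_upper_ray; auto|]. split; auto.
  apply (well_orderable_lexicographic X W g); auto; [apply cg|]. intros w.
  destruct (classic (w = g x)) as [->|ne].
  { apply well_orderable_subsingleton. intros a b [_ Ha] [_ Hb].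
    transitivity x; [|symmetry]; apply NNPP; intros n; apply gx in n; worder. }
  destruct (fib w ne) as [ow|sw]; [|apply well_orderable_subsingleton; firstorder].
  destruct (classic (d << w)) as [Hdw|Hdw];
    [|apply well_orderable_subsingleton; intros a b [H1 H2] _; worder].
  apply clopen_well_orderable; auto.
  - split; [apply open_inter; auto; apply cg|].
    eapply open_ext; [|apply (open_or X _ _ (proj1 (cg w)) (proj2 (cg w)))].
    intros y; simpl; split.
    + intros [h|h] [_ e]; worder.
    + intros h. destruct (wo_total W (g y) w) as [h'|[h'|h']]; auto.
      exfalso; apply h; subst; auto.
  - intros y [Hy ey]. apply HU; auto. intros ->; auto.
Qed.

(** * Layerings from filtrations by clopen sets *)

Section Filtration.

Context (X : Top) (x : X) (W : WellOrder) (f : X -> W).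
Hypothesis cf : ray_continuous X W f.
Hypothesis f_max : forall y, y <> x -> f y << f x.

(* Closedness is expressed by the existence of largest elements below a bound. *)
Definition club (C : W -> Prop) : Prop :=
  (forall c, C c -> c << f x) /\
  (forall d, d << f x -> exists c, C c /\ d << c) /\
  (forall w, w << f x -> (exists c, C c /\ ~ w << c) ->
     exists m, C m /\ ~ w << m /\ forall c, C c -> ~ w << c -> ~ m << c).

Definition club_limit (C : W -> Prop) (c : W) : Prop :=
  (exists e, C e /\ e << c) /\ forall d, d << c -> exists e, C e /\ d << e /\ e << c.

Definition sandwiched (D : X -> Prop) (c : W) : Prop :=
  clopen X D /\ (forall y, f y << c -> D y) /\ (forall y, D y -> ~ c << f y).

(** Each [y] other than [x] goes to the least [c] in [C] with [y] in [D c], so that [g] is at most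
    [c] exactly on [D c]. At a non-limit level the fibre is a difference of clopen sets. At a limit
    level a point of height below [c] would already lie in an earlier [D e], so the last hypothesis
    leaves at most one point. *)
Lemma filtration_layering (C : W -> Prop) (D : W -> X -> Prop) :
  club C -> (forall c, C c -> sandwiched (D c) c) ->
  (forall c, C c -> club_limit C c ->
     forall a b, D c a -> ~ f a << c -> D c b -> ~ f b << c -> a = b) ->
  exists g, layering X x W g /\ g x = f x.
Proof.
  intros [Cx [Cu Ccl]] HD Hlim.
  destruct (choice_fun (fun y w => (y = x /\ w = f x) \/
     (y <> x /\ C w /\ D w y /\ forall c, C c -> D c y -> ~ c << w))) as [g Hg].
  { intros y. destruct (classic (y = x)) as [e|n]; [eauto|].
    destruct (wo_least W (fun c => C c /\ D c y)) as [c [[Cc Dc] Hc]].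
    - destruct (Cu (f y) (f_max y n)) as [c [Cc Hc]]. exists c; split; auto. apply HD; auto.
    - exists c. right. repeat split; auto. }
  assert (gx : g x = f x) by (destruct (Hg x) as [[_ h]|[h _]]; auto; contradiction).
  assert (gC : forall y, y <> x -> C (g y) /\ D (g y) y /\ forall c, C c -> D c y -> ~ c << g y).
  { intros y n. destruct (Hg y) as [[h _]|[_ h]]; auto; contradiction. }
  assert (gmax : forall y, y <> x -> g y << g x).
  { intros y n. rewrite gx. apply Cx, gC; auto. }
  assert (Dx : forall c, C c -> ~ D c x).
  { intros c Cc Dcx. apply (proj2 (proj2 (HD c Cc))) in Dcx. apply Dcx. auto. }
  assert (Dmono : forall c c' y, C c -> C c' -> ~ c' << c -> D c y -> D c' y).
  { intros c c' y Cc Cc' Hcc Dy. destruct (classic (c = c')) as [->|n]; auto.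
    apply (HD c' Cc'). apply (proj2 (proj2 (HD c Cc))) in Dy. worder. }
  assert (gle : forall c y, C c -> (D c y <-> ~ c << g y)).
  { intros c y Cc. split.
    - intros Dy. apply gC; auto. intros ->. exact (Dx c Cc Dy).
    - intros Hy. assert (n : y <> x).
      { intros ->. apply Hy. rewrite gx. auto. }
      destruct (gC y n) as [C1 [D1 _]]. apply (Dmono (g y)); auto. }
  assert (cg : ray_continuous X W g).
  { intros w; split.
    - destruct (classic (g x << w)) as [Hw|Hw].
      + eapply open_ext; [|apply open_full]. intros y; split; auto. intros _.
        destruct (classic (y = x)) as [->|n]; auto. specialize (gmax y n); worder.
      + apply open_local. intros y Hy.
        assert (n : y <> x) by (intros ->; auto). destruct (gC y n) as [C1 [D1 _]].
        exists (D (g y)). split; [apply HD; auto|]. split; auto.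
        intros z Dz. apply gle in Dz; auto. worder.
    - destruct (classic (w << g x)) as [Hw|Hw].
      + destruct (classic (exists c, C c /\ ~ w << c)) as [HC|HC].
        (* The upper ray at [w] is the complement of [D m], with [m] the largest element of [C] up
           to [w]. *)
        * rewrite gx in Hw. destruct (Ccl w Hw HC) as [m [Cm [Hm Hmax]]].
          eapply open_ext; [|apply (proj2 (proj1 (HD m Cm)))]. intros y; simpl.
          rewrite gle by auto. split.
          -- intros H. apply NNPP in H. destruct (classic (y = x)) as [->|n]; [congruence|].
             destruct (gC y n) as [C1 _]. apply NNPP; intros H'.
             specialize (Hmax (g y) C1 H'). worder.
          -- intros H. intro. worder.
        * eapply open_ext; [|apply open_full]. intros y; split; auto. intros _.
          destruct (classic (y = x)) as [->|n]; auto.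
          apply NNPP; intros H. apply HC. exists (g y). split; auto. apply gC; auto.
      + eapply open_ext; [|apply open_empty]. intros y; split; [tauto|]. intros H.
        destruct (classic (y = x)) as [->|n]; auto. specialize (gmax y n). worder. }
  exists g. split; [|auto]. split; auto. split; auto. intros w nw.
  destruct (classic (exists y, g y = w)) as [[y Hy]|Hn];
    [|right; intros a b Ha; exfalso; eauto].
  assert (n : y <> x) by (intros ->; auto).
  assert (Cw : C w) by (subst; apply gC; auto).
  destruct (classic (club_limit C w)) as [Hl|Hl].
  - right.
    assert (Hw : forall a, g a = w -> D w a /\ ~ f a << w).
    { intros a Ha. split; [apply gle; auto; worder|]. intros Hfa.
      destruct (proj2 Hl (f a) Hfa) as [e [Ce [He1 He2]]].
      assert (De : D e a) by (apply HD; auto). apply gle in De; auto. worder. }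
    intros a b Ha Hb. destruct (Hw a Ha), (Hw b Hb). apply (Hlim w); auto.
  - left. assert (owle : is_open X (fun z => ~ w << g z))
      by (apply ray_continuous_le; auto).
    destruct (classic (exists e, C e /\ e << w)) as [He|He].
    + assert (Hd : exists d, d << w /\ forall e, C e -> e << w -> ~ d << e).
      { apply NNPP; intros Hd. apply Hl. split; auto. intros d Hdw.
        apply NNPP; intros Hn. apply Hd. exists d. split; auto.
        intros e Ce He1 He2. apply Hn. eauto. }
      destruct Hd as [d [Hdw Hd]].
      eapply open_ext; [|apply (open_inter X _ _ owle (proj2 (cg d)))]. intros z; simpl; split.
      * intros [H1 H2]. destruct (classic (z = x)) as [->|nz].
        { exfalso. apply H1. rewrite gx. auto. }
        destruct (gC z nz) as [Cz _]. apply NNPP; intros H3.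
        apply (Hd (g z)); auto. worder.
      * intros <-. split; auto. apply wo_irrefl.
    + eapply open_ext; [|apply owle]. intros z; simpl; split.
      * intros H1. destruct (classic (z = x)) as [->|nz].
        { exfalso. apply H1. rewrite gx. auto. }
        destruct (gC z nz) as [Cz _]. apply NNPP; intros H3. apply He. exists (g z).
        split; auto. worder.
      * intros <-. apply wo_irrefl.
Qed.

Lemma finite_range_max (s : nat -> W) (n : nat) (Q : W -> Prop) :
  (forall c, Q c -> exists i, i < n /\ c = s i) -> (exists c, Q c) ->
  exists m, Q m /\ forall c, Q c -> ~ m << c.
Proof.
  revert Q. induction n as [|n IH]; intros Q HQ [c Qc].
  - destruct (HQ c Qc) as [i [Hi _]]. lia.
  - destruct (classic (exists c, (Q c /\ s n << c))) as [H|H].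
    + destruct (IH (fun c => Q c /\ s n << c)) as [m [[Qm Hm] Hmax]]; auto.
      { intros e [Qe He]. destruct (HQ e Qe) as [i [Hi ->]].
        exists i; split; auto. destruct (PeanoNat.Nat.eq_dec i n) as [->|]; [|lia].
        exfalso; exact (wo_irrefl _ _ He). }
      exists m; split; auto. intros e Qe Hme. apply (Hmax e); auto. split; auto. worder.
    + destruct (classic (Q (s n))) as [Qn|nQn].
      * exists (s n); split; auto. intros e Qe He. eauto.
      * apply IH; [|eauto]. intros e Qe. destruct (HQ e Qe) as [i [Hi ->]].
        exists i; split; auto. destruct (PeanoNat.Nat.eq_dec i n) as [->|]; [|lia]. contradiction.
Qed.

Lemma cofinal_sequence_layering (s : nat -> W) :
  (forall n, s n << f x) -> (forall d, d << f x -> exists n, d << s n) ->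
  exists g, layering X x W g /\ g x = f x.
Proof.
  intros sx su.
  (* The records of [s] form a cofinal subset without limits. *)
  pose (C := fun c => exists n, c = s n /\ forall i, i < n -> s i << c).
  (* A record not exceeding [s n] occurs at an index at most [n], so only finitely many records lie
     below any given height under [f x]. *)
  assert (Cbelow : forall n c, C c -> ~ s n << c -> exists i, i < S n /\ c = s i).
  { intros n c [i [-> Hi]] Hn. exists i; split; auto.
    apply PeanoNat.Nat.nlt_ge; intros h. apply Hn, Hi. lia. }
  apply (filtration_layering C (fun c y => ~ c << f y)).
  - split; [|split].
    + intros c [n [-> _]]; auto.
    + intros d Hd.
      destruct (su d Hd) as [n0 Hn0].
      assert (H : exists n, d << s n /\ forall i, i < n -> ~ d << s i).
      { clear -Hn0. induction n0 as [n0 IH] using (well_founded_ind PeanoNat.Nat.lt_wf_0).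
        destruct (classic (exists i, i < n0 /\ d << s i)) as [[i [Hi Hdi]]|H]; [eauto|].
        exists n0; split; auto. intros i Hi Hdi. eauto. }
      destruct H as [n [Hn Hmin]]. exists (s n). split; auto.
      exists n; split; auto. intros i Hi. specialize (Hmin i Hi). worder.
    + intros w Hw HC. destruct (su w Hw) as [n Hn].
      destruct (finite_range_max s (S n) (fun c => C c /\ ~ w << c)) as [m [[Cm Hm] Hmax]]; auto.
      * intros c [Cc Hc]. apply Cbelow; auto. worder.
      * exists m; repeat split; auto.
  - intros c Cc. split; [|split].
    + split; [apply ray_continuous_le; auto|].
      eapply open_ext; [|apply (proj2 (cf c))]. intros y; simpl; split; [tauto|apply NNPP].
    + worder.
    + auto.
  - intros c [n [-> Hn]] [He Hl]. exfalso.
    destruct (finite_range_max s (S n) (fun c => C c /\ c << s n)) as [m [[Cm Hm] Hmax]]; auto.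
    + intros c [Cc Hc]. apply Cbelow; auto. worder.
    + destruct (Hl m Hm) as [e [Ce [He1 He2]]]. apply (Hmax e); auto.
Qed.

End Filtration.

(** * Uncountable cofinality *)

Section UncountableCofinality.

Context (X : Top) (x : X) (W : WellOrder) (f : X -> W).
Hypothesis cX : compact X.
Hypothesis cf : ray_continuous X W f.
Hypothesis f_max : forall y, y <> x -> f y << f x.
Hypothesis x_limit : forall d, d << f x -> exists y, y <> x /\ d << f y.
Hypothesis x_not_least : exists d, d << f x.
Hypothesis sequences_bounded : forall s : nat -> W,
  (forall n, s n << f x) -> exists d, d << f x /\ forall n, ~ d << s n.

Definition good_cut (c : W) : Prop :=
  exists D, sandwiched X W f D c /\
    forall a b, D a -> ~ f a << c -> D b -> ~ f b << c -> a = b.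

Definition adherent_below (q : X) : Prop :=
  forall U, is_open X U -> U q -> exists z, U z /\ f z << f q.

(** Without adherent points at height [c], the set where [f y << c] is itself clopen. *)
Lemma good_cut_or_adherent (c : W) :
  good_cut c \/ exists q, f q = c /\ adherent_below q.
Proof.
  apply NNPP; intros H. apply H. left. exists (fun y => f y << c).
  split; [|intros; contradiction]. split; [|split; [auto|worder]].
  split; [apply cf|]. apply open_local. intros y Hy.
  destruct (classic (f y = c)) as [e|n].
  - apply NNPP; intros Hn. apply H. right. exists y; split; auto.
    intros U oU Uy. apply NNPP; intros Hz. apply Hn. exists U. repeat split; auto.
    intros z Uz Hzc. apply Hz. exists z. rewrite e. auto.
  - exists (fun z => c << f z). split; [apply cf|]. split; [worder|worder].
Qed.

(* [b] bounds every point that the map [k] does not place strictly above the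
   points of height at most [a]; heights are read off [f], above [eta]. *)
Definition dominates (k : X -> W) (eta a b : W) : Prop :=
  forall z q, eta << f z -> ~ a << f z -> eta << f q -> ~ k z << k q -> ~ b << f q.

(** Compactness is used twice: [k] is bounded below [k x] on the points above [eta] of height at
    most [a], and then [f] is bounded below [f x] on the points above [eta] where [k] does not
    exceed that bound. *)
Lemma dominates_exists (k : X -> W) (eta a : W) :
  ray_continuous X W k -> (forall y, y <> x -> eta << f y -> k y << k x) ->
  eta << f x -> a << f x -> exists b, b << f x /\ dominates k eta a b.
Proof.
  intros ck kx Heta Ha.
  destruct (classic (exists d, d << k x)) as [Hd|Hd].
  - destruct (compact_bounded X W k (fun z => eta << f z /\ ~ a << f z) (k x)) as [d [Hdx H]]; auto.
    + eapply open_ext; [|apply (open_or X _ _ (ray_continuous_le X W f eta cf) (proj2 (cf a)))].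
      intros y; simpl. destruct (classic (eta << f y)), (classic (a << f y)); tauto.
    + intros y [H1 H2]. apply kx; auto. intros ->; auto.
    + destruct (compact_bounded X W f (fun q => eta << f q /\ ~ d << k q) (f x)) as [b [Hb H']]; auto.
      * eapply open_ext; [|apply (open_or X _ _ (ray_continuous_le X W f eta cf) (proj2 (ck d)))].
        intros y; simpl. destruct (classic (eta << f y)), (classic (d << k y)); tauto.
      * intros y [H1 H2]. apply f_max. intros ->; auto.
      * exists b; split; auto. intros z q H1 H2 H3 H4. apply H'. split; auto.
        specialize (H z (conj H1 H2)). worder.
  (* If nothing lies below [k x], no point other than [x] is above [eta], and domination is
     vacuous. *)
  - exists a; split; auto. intros z q H1 H2 _ _. exfalso. apply Hd. exists (k z).
    apply kx; auto. intros ->; auto.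
Qed.

(** If [p] is adherent at height [c], no [y] of height [c] has [k y << k p]: some [z] near [p] and
    below [c] would have [k z] above [k y], and domination would force [y] below [c]. As [k]
    separates [q] from the rest of its level, [q] is the only adherent point there, and adding it to
    the points below [c] gives a clopen set. *)
Lemma collision_good_cut (A : X -> Prop) (k : X -> W) (eta c : W) (q : X) :
  ray_continuous X W k -> (forall a b, A a -> ~ A b -> k a <> k b) ->
  eta << c -> (forall a, a << c -> exists b, b << c /\ dominates k eta a b) ->
  f q = c -> adherent_below q -> ~ A q -> (forall y, f y = c -> y <> q -> A y) ->
  good_cut c.
Proof.
  intros ck kA Heta Hdom fq adq nAq HA.
  assert (key : forall p y, f p = c -> adherent_below p -> f y = c -> ~ k y << k p).
  { intros p y fp adp fy Hlt.
    destruct (adp (fun z => k y << k z /\ eta << f z)) as [z [[Hz1 Hz2] Hz3]].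
    - apply open_inter; [apply ck|apply cf].
    - split; auto. worder.
    - rewrite fp in Hz3. destruct (Hdom (f z) Hz3) as [b [Hb Hd]].
      apply (Hd z y); auto; worder. }
  assert (sep : forall y, f y = c -> y <> q -> k q << k y).
  { intros y fy n. assert (k y <> k q) by (apply kA; auto).
    specialize (key q y fq adq fy). worder. }
  exists (fun y => f y << c \/ y = q). split.
  - split; [split|split].
    + apply open_local. intros y [Hy| ->].
      * exists (fun y => f y << c). split; [apply cf|]. auto.
      (* Near [q], bounding [k] by [k q] leaves no other point of height [c]. *)
      * exists (fun y => ~ k q << k y /\ ~ c << f y). split.
        { apply open_inter; apply ray_continuous_le; auto. }
        split; [split; worder|].
        intros y [H1 H2]. destruct (classic (y = q)) as [|n]; auto. left.
        apply NNPP; intros H3. apply H1, sep; auto. worder.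
    + apply open_local. intros y Hy.
      destruct (classic (f y = c)) as [e|n].
      * assert (nyq : y <> q) by tauto. pose proof (sep y e nyq) as Hlt.
        assert (nad : ~ adherent_below y).
        { intros ady. exact (key y q e ady fq Hlt). }
        apply not_all_ex_not in nad as [U HU].
        apply imply_to_and in HU as [oU HU]. apply imply_to_and in HU as [Uy HU].
        exists (fun z => U z /\ k q << k z). split; [apply open_inter; auto; apply ck|].
        split; auto. intros z [Uz Hz] [H1| ->]; [|worder].
        apply HU. exists z. rewrite e. auto.
      * exists (fun z => c << f z). split; [apply cf|].
        assert (~ f y << c) by tauto. split; [worder|].
        intros z Hz [H1| ->]; worder.
    + auto.
    + intros y [Hy| ->]; worder.
  - intros a b [Ha| ->] H1 [Hb| ->] H2; auto; contradiction.
Qed.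

(** * Closed unbounded sets of closure points *)

Section Closure.

Context (T : W -> W -> Prop).
Hypothesis T_total : forall a, a << f x -> exists b, b << f x /\ T a b.
Hypothesis T_mono : forall a a' b b', ~ a << a' -> ~ b' << b -> T a b -> T a' b'.

(** The relation [T] stays abstract: it is [dominates] alone at first, and later [dominates]
    combined with the presence of thread points. *)
Definition closed_under (c : W) : Prop := forall a, a << c -> exists b, b << c /\ T a b.

Lemma sequence_sup (s : nat -> W) : (forall n, s n << f x) -> (forall n, s n << s (S n)) ->
  exists c, c << f x /\ (forall n, s n << c) /\ forall a, a << c -> exists n, ~ s n << a.
Proof.
  intros sx smono. destruct (sequences_bounded s sx) as [d [Hd Hs]].
  destruct (wo_least W (fun c => forall n, s n << c)) as [c [Hc Hmin]].
  { exists (f x); auto. }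
  exists c. split; [|split; auto].
  - assert (Hdc : ~ d << c) by
      (apply Hmin; intros n; specialize (Hs (S n)); specialize (smono n); worder).
    worder.
  - intros a Ha. apply NNPP; intros H. apply (Hmin a); auto.
    intros n. apply NNPP; intros Hn. eauto.
Qed.

(** Iterate [T] along an increasing sequence from [d]. Anything below the supremum is at most some
    term, and the next term answers for it. *)
Lemma closed_under_unbounded (d : W) :
  d << f x -> exists c, c << f x /\ d << c /\ closed_under c.
Proof.
  intros Hd.
  destruct (dependent_choice (fun a => a << f x) (fun a b => a << b /\ T a b) d Hd)
    as [s [s0 Hs]].
  { intros a Ha. destruct (T_total a Ha) as [b [Hb Tb]].
    destruct (x_limit a Ha) as [y [ny Hy]]. pose proof (f_max y ny).
    destruct (wo_max W b (f y)) as [m [H1 [H2 H3]]].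
    exists m. repeat split.
    - destruct H3; subst; auto.
    - worder.
    - apply (T_mono a a b m); auto. apply wo_irrefl. }
  destruct (sequence_sup s) as [c [Hc [Hsc Hmin]]]; try apply Hs.
  exists c. split; auto. split; [rewrite <- s0; auto|].
  intros a Ha. destruct (Hmin a Ha) as [n Hn]. exists (s (S n)). split; auto.
  apply (T_mono (s n) a (s (S n)) (s (S n))); auto; [apply wo_irrefl|apply Hs].
Qed.

Lemma closed_under_club (eta : W) :
  eta << f x -> club X x W f (fun c => eta << c /\ c << f x /\ closed_under c).
Proof.
  intros Heta. split; [tauto|split].
  - intros d Hd. destruct (wo_max W d eta) as [m [H1 [H2 H3]]].
    destruct (closed_under_unbounded m) as [c [Hc [Hmc Tc]]].
    { destruct H3; subst; auto. }
    exists c. repeat split; auto; worder.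
  - intros w Hw [c0 [[Hc0 [Hc0x Tc0]] Hwc0]].
    (* The largest closure point up to [w] is the supremum of all of them up to [w]. *)
    destruct (wo_least W (fun m => forall c, eta << c /\ c << f x /\ closed_under c -> ~ w << c ->
      ~ m << c)) as [m [Hm Hmin]].
    { exists w; auto. }
    assert (Hmw : ~ w << m) by (apply Hmin; auto).
    assert (Hc0m : ~ m << c0) by (apply Hm; auto).
    exists m. split; [|auto]. split; [worder|]. split; [worder|].
    intros a Ha. apply NNPP; intros Hn.
    apply (Hmin a); auto. intros c Hc Hwc Hac. apply Hn.
    destruct Hc as [H1 [H2 Tc]]. destruct (Tc a Hac) as [b [Hb Tab]].
    exists b; split; auto. assert (~ m << c) by (apply Hm; auto). worder.
Qed.

End Closure.

(** Otherwise every point has an open neighbourhood in which the heights of [M] below [c] are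
    bounded away from [c]. Such open sets are directed, so one would be all of [X], contradicting
    the choice of [M]. *)
Lemma adherent_limit (M : X -> Prop) (c : W) :
  (exists d, d << c) -> (forall d, d << c -> exists m, M m /\ d << f m /\ f m << c) ->
  exists q, f q = c /\ forall U, is_open X U -> U q -> exists m, U m /\ M m /\ f m << c.
Proof.
  intros [d0 Hd0] Hc. apply NNPP; intros Hn.
  destruct (compact_directed X (fun U => is_open X U /\
    exists d, d << c /\ forall m, U m -> M m -> d << f m -> ~ f m << c)) as [U [[_ [d [Hd H]]] HU]].
  - auto.
  - tauto.
  - exists (fun _ => False). split; [apply open_empty|]. exists d0; tauto.
  - intros U V [oU [d [Hd HdU]]] [oV [e [He HeV]]].
    exists (fun y => U y \/ V y). split; auto. split; [apply open_or; auto|].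
    destruct (wo_max W d e) as [m [H1 [H2 H3]]]. exists m. split.
    + destruct H3; subst; auto.
    + intros y [Uy|Vy] My Hy.
      * apply HdU; auto. worder.
      * apply HeV; auto. worder.
  - intros y. destruct (wo_total W (f y) c) as [h|[h|h]].
    + exists (fun z => ~ f y << f z). split; [|apply wo_irrefl].
      split; [apply ray_continuous_le; auto|]. exists (f y). auto.
    + apply NNPP; intros HU. apply Hn. exists y. split; auto. intros U oU Uy.
      apply NNPP; intros Hm. apply HU. exists U. split; auto. split; auto. exists d0. split; auto.
      intros m Um Mm _ Hmc. eauto.
    + exists (fun z => c << f z). split; auto. split; [apply cf|]. exists d0; split; auto. worder.
  - destruct (Hc d Hd) as [m [Mm [H1 H2]]]. exact (H m (HU m) Mm H1 H2).
Qed.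

(* Points sent strictly above [k x] stay away from [x]. *)
Lemma top_fibre_dichotomy (k : X -> W) :
  ray_continuous X W k ->
  (exists eta, eta << f x /\ forall y, y <> x -> eta << f y -> k y << k x) \/
  (forall d, d << f x -> exists y, y <> x /\ d << f y /\ k y = k x).
Proof.
  intros ck. apply NNPP; intros Hn. apply Hn. right. intros d Hd.
  apply NNPP; intros Hd'. apply Hn. left.
  destruct (compact_bounded X W f (fun y => k x << k y) (f x)) as [e [He H]]; auto.
  - apply ray_continuous_le; auto.
  - intros y Hy. apply f_max. intros ->. exact (wo_irrefl _ _ Hy).
  - destruct (wo_max W d e) as [m [H1 [H2 H3]]]. exists m. split.
    + destruct H3; subst; auto.
    + intros y ny Hy. assert (Hke : ~ k x << k y).
      { intros h. apply (H y h). worder. }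
      assert (Hne : k y <> k x).
      { intros h. apply Hd'. exists y. repeat split; auto. worder. }
      worder.
Qed.

(** * Threads of adherent points at bad heights *)

Hypothesis cleavable : cleavable_over X W.

Lemma cleave (A : X -> Prop) :
  exists k, ray_continuous X W k /\ forall a b, A a -> ~ A b -> k a <> k b.
Proof.
  destruct (cleavable A) as [k [ck Hk]]. exists k. auto using continuous_ray_continuous.
Qed.

Lemma dominates_mono (k : X -> W) (eta a a' b b' : W) :
  ~ a << a' -> ~ b' << b -> dominates k eta a b -> dominates k eta a' b'.
Proof.
  intros Ha Hb H z q H1 H2 H3 H4. assert (~ b << f q) by (apply (H z q); auto; worder). worder.
Qed.

(** An unbounded set of bad heights lifted to [X], with one point over each; the third clause says
    that the lift is closed away from [x]. *)
Definition thread (M : X -> Prop) : Prop :=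
  (forall y, M y -> y <> x /\ ~ good_cut (f y) /\ adherent_below y) /\
  (forall y z, M y -> M z -> f y = f z -> y = z) /\
  (forall y, y <> x -> (forall U, is_open X U -> U y -> exists m, U m /\ M m) -> M y) /\
  (forall d, d << f x -> exists m, M m /\ d << f m).

Lemma stationary_bad_cuts_thread :
  (forall C, club X x W f C -> exists c, C c /\ ~ good_cut c) -> exists M, thread M.
Proof.
  intros Hst.
  destruct (choice_fun (fun c q => good_cut c \/ (f q = c /\ adherent_below q))) as [q Hq].
  (* At a good height [x] is a placeholder, ignored because the cleaved set also tests for a bad
     height. *)
  { intros c. destruct (good_cut_or_adherent c) as [H|[p H]]; [exists x|exists p]; auto. }
  destruct (cleave (fun y => y <> x /\ ~ (~ good_cut (f y) /\ y = q (f y)))) as [k [ck Hk]].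
  destruct (top_fibre_dichotomy k ck) as [[eta [Heta Hlt]]|Hun].
  - exfalso.
    destruct (Hst _ (closed_under_club (dominates k eta)
      (fun a Ha => dominates_exists k eta a ck Hlt Heta Ha) (dominates_mono k eta) eta Heta))
      as [c [[Hec [Hcx Hc]] Hbad]].
    apply Hbad. destruct (Hq c) as [?|[fq adq]]; [contradiction|].
    apply (collision_good_cut _ k eta c (q c) ck Hk); auto.
    + rewrite fq. tauto.
    + intros y fy ny. split; [intros ->; worder|]. rewrite fy. tauto.
  - exists (fun y => y <> x /\ k y = k x).
    assert (HM : forall y, y <> x /\ k y = k x -> ~ good_cut (f y) /\ y = q (f y)).
    { intros y [ny ky]. apply NNPP; intros Hn. apply (Hk y x); tauto. }
    split; [|split; [|split]].
    + intros y Hy. destruct (HM y Hy) as [Hb e]. destruct Hy as [ny _].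
      destruct (Hq (f y)) as [?|[_ adq]]; [contradiction|]. rewrite <- e in adq. auto.
    + intros y z Hy Hz e. rewrite (proj2 (HM y Hy)), (proj2 (HM z Hz)), e. reflexivity.
    + intros y ny Hy. split; auto.
      destruct (wo_total W (k y) (k x)) as [h|[h|h]]; auto; exfalso.
      * destruct (Hy (fun z => k z << k x)) as [m [Hm [_ e]]]; auto; [apply ck|worder].
      * destruct (Hy (fun z => k x << k z)) as [m [Hm [_ e]]]; auto; [apply ck|worder].
    + intros d Hd. destruct (Hun d Hd) as [y [ny [Hy ky]]]. exists y; auto.
Qed.

Lemma no_thread (M : X -> Prop) : ~ thread M.
Proof.
  intros [Mbad [Minj [Mclosed Munb]]].
  pose (lim := fun y => forall d, d << f y -> exists m, M m /\ d << f m /\ f m << f y).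
  (* Closedness puts the point supplied by [adherent_limit] back on the thread. *)
  assert (Mlimit : forall c, c << f x -> (exists d, d << c) -> forall M' : X -> Prop,
    (forall m, M' m -> M m) ->
    (forall d, d << c -> exists m, M' m /\ d << f m /\ f m << c) ->
    exists q, M q /\ f q = c /\
      forall U, is_open X U -> U q -> exists m, U m /\ M' m).
  { intros c Hcx Hd M' HM' Hc. destruct (adherent_limit M' c Hd Hc) as [q [fq Hq]].
    exists q. split; [|split; auto].
    - apply Mclosed.
      + intros ->. worder.
      + intros U oU Uq. destruct (Hq U oU Uq) as [m [H1 [H2 _]]]. eauto.
    - intros U oU Uq. destruct (Hq U oU Uq) as [m [H1 [H2 _]]]. eauto. }
  destruct (cleave (fun y => y <> x /\ ~ (M y /\ lim y))) as [k [ck Hk]].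
  destruct (top_fibre_dichotomy k ck) as [[eta [Heta Hlt]]|Hun].
  (* Demanding a thread point at each step makes [c] a limit of thread heights. The thread point at
     height [c] is then a limit point of the thread, the only one at this height, so
     [collision_good_cut] contradicts badness. *)
  - pose (T := fun a b => dominates k eta a b /\ exists m, M m /\ a << f m /\ ~ b << f m).
    destruct (closed_under_unbounded T) with (d := eta) as [c [Hcx [Hec Hc]]]; auto.
    { intros a Ha. destruct (dominates_exists k eta a ck Hlt Heta Ha) as [b [Hb Hab]].
      destruct (Munb a Ha) as [m [Mm Hm]].
      assert (f m << f x) by (apply f_max, Mbad; auto).
      destruct (wo_max W b (f m)) as [e [H1 [H2 H3]]]. exists e. split.
      - destruct H3; subst; auto.
      - split; [apply (dominates_mono k eta a a b e); auto; apply wo_irrefl|eauto]. }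
    { intros a a' b b' Ha Hb [H1 [m [Mm [H2 H3]]]]. split.
      - apply (dominates_mono k eta a a' b b'); auto.
      - exists m. repeat split; auto; worder. }
    assert (Hlim : forall d, d << c -> exists m, M m /\ d << f m /\ f m << c).
    { intros d Hd. destruct (Hc d Hd) as [b [Hb [_ [m [Mm [H1 H2]]]]]].
      exists m. repeat split; auto. worder. }
    destruct (Mlimit c Hcx) with (M' := M) as [q [Mq [fq _]]]; eauto.
    destruct (Mbad q Mq) as [nq [Hbad adq]]. apply Hbad.
    apply (collision_good_cut _ k eta (f q) q ck Hk); auto.
    + worder.
    + rewrite fq. intros a Ha. destruct (Hc a Ha) as [b [Hb [H _]]]. eauto.
    + intros [_ H]. apply H. split; auto. intros d Hd. rewrite fq in *. auto.
    + intros y fy ny. split; [intros ->; worder|]. intros [My _]. apply ny, Minj; auto.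
  - assert (HM2 : forall y, y <> x -> k y = k x -> M y /\ lim y).
    { intros y ny ky. apply NNPP; intros Hn. apply (Hk y x); tauto. }
    pose (Q := fun y => M y /\ k y << k x).
    assert (Qunb : forall d, d << f x -> exists z, Q z /\ d << f z).
    { intros d Hd.
      destruct (compact_bounded X W f (fun y => k x << k y) (f x)) as [e [He Hhigh]]; auto.
      { apply ray_continuous_le; auto. }
      { intros y Hy. apply f_max. intros ->. exact (wo_irrefl _ _ Hy). }
      destruct (wo_max W d e) as [b [H1 [H2 H3]]].
      assert (Hb : b << f x) by (destruct H3; subst; auto).
      destruct (Munb b Hb) as [m0 [Mm0 Hm0]].
      assert (Hm0x : f m0 << f x) by (apply f_max, Mbad; auto).
      (* The next thread point after [m0] is not a limit, so [k] separates it from [x]; this high up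
         its value cannot exceed [k x]. *)
      destruct (wo_least W (fun w => exists m, M m /\ f m0 << f m /\ f m = w))
        as [w [[m [Mm [Hm <-]]] Hmin]].
      { destruct (Munb (f m0) Hm0x) as [m [Mm Hm]]. eauto. }
      exists m. split; [|worder]. split; auto.
      assert (nx : m <> x) by (apply Mbad; auto).
      assert (~ k x << k m) by (intros h; apply (Hhigh m h); worder).
      assert (k m <> k x).
      { intros h. destruct (HM2 m nx h) as [_ Hl].
        destruct (Hl (f m0) Hm) as [m' [Mm' [H4 H5]]]. apply (Hmin (f m')); eauto. }
      worder. }
    (* Interleave points of [Q] with points of the fibre of [k x]: both
       sequences converge to the same point of [M]. *)
    destruct x_not_least as [d0 Hd0]. destruct (Qunb d0 Hd0) as [z0 [Qz0 _]].
    destruct (dependent_choice Q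
      (fun z z' => exists m, m <> x /\ k m = k x /\ f z << f m /\ f m << f z') z0 Qz0)
      as [z [_ Hz]].
    { intros y [My _].
      destruct (Hun (f y)) as [m [nm [Hm km]]]; [apply f_max, Mbad; auto|].
      destruct (Qunb (f m)) as [z' [Qz' Hz']]; [auto|]. exists z'. eauto 7. }
    assert (zx : forall n, f (z n) << f x) by (intros n; apply f_max, Mbad, Hz).
    assert (zmono : forall n, f (z n) << f (z (S n))).
    { intros n. destruct (Hz n) as [_ [m [_ [_ [H1 H2]]]]]. worder. }
    destruct (sequence_sup (fun n => f (z n)) zx zmono) as [c [Hcx [Hzc Hmin]]].
    assert (Hd : exists d, d << c) by (exists (f (z 0)); apply Hzc).
    destruct (Mlimit c Hcx Hd (fun y => exists n, y = z n)) as [q [Mq [fq Hq]]].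
    { intros m [n ->]. apply Hz. }
    { intros d Hdc. destruct (Hmin d Hdc) as [n Hn]. exists (z (S n)).
      split; [eauto|]. split; auto. specialize (zmono n). worder. }
    destruct (Mlimit c Hcx Hd (fun y => y <> x /\ k y = k x)) as [q' [Mq' [fq' Hq']]].
    { intros m [nm km]. apply HM2; auto. }
    { intros d Hdc. destruct (Hmin d Hdc) as [n Hn].
      destruct (Hz n) as [_ [m [nm [km [H1 H2]]]]]. exists m. split; auto.
      specialize (Hzc (S n)). simpl in *. split; worder. }
    assert (e : q' = q) by (apply Minj; auto; congruence). subst q'.
    (* The values of [k] along [z] stay below that of a fixed further point
       [z'], since each [k]-initial segment is bounded in [f]. *)
    destruct (choice_fun (fun n b => b << f x /\ forall y, ~ k (z n) << k y -> ~ b << f y))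
      as [b Hb].
    { intros n. destruct (compact_bounded X W f (fun y => ~ k (z n) << k y) (f x)) as [b Hb]; eauto.
      - eapply open_ext; [|apply (proj2 (ck (k (z n))))].
        intros y; simpl; split; [tauto|apply NNPP].
      - intros y Hy. apply f_max. intros ->. apply Hy, Hz. }
    destruct (sequences_bounded b) as [b' [Hb'x Hb']]; [apply Hb|].
    destruct (Qunb b' Hb'x) as [z' [[_ Qz'] Hz']].
    assert (Hkz : forall n, k (z n) << k z').
    { intros n. apply NNPP; intros Hn. apply (proj2 (Hb n)) in Hn. specialize (Hb' n). worder. }
    assert (Hkq : ~ k z' << k q).
    { intros h. destruct (Hq (fun y => k z' << k y)) as [m [Hm [n ->]]]; auto; [apply ck|].
      specialize (Hkz n). worder. }
    (* By now [k q] is at most [k z'], hence below [k x]; but [q] is adherent to points of value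
       [k x]. *)
    destruct (Hq' (fun y => k y << k x)) as [m [Hm [_ km]]]; [apply ck|worder|worder].
Qed.

Lemma bounded_sequences_layering : exists g, layering X x W g /\ g x = f x.
Proof.
  destruct (classic (exists C, club X x W f C /\ forall c, C c -> good_cut c))
    as [[C [HC Hgood]]|Hn].
  - destruct (choice_fun (fun c D => C c -> sandwiched X W f D c /\
      forall a b, D a -> ~ f a << c -> D b -> ~ f b << c -> a = b)) as [D HD].
    { intros c. destruct (classic (C c)) as [Cc|nCc].
      - destruct (Hgood c Cc) as [D HD]. eauto.
      - exists (fun _ => True). tauto. }
    apply (filtration_layering X x W f f_max C D); auto.
    + intros c Cc. apply (HD c Cc).
    + intros c Cc _. apply (HD c Cc).
  - exfalso. destruct stationary_bad_cuts_thread as [M HM]; [|exact (no_thread M HM)].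
    intros C HC. apply NNPP; intros H. apply Hn. exists C. split; auto.
    intros c Cc. apply NNPP; intros Hb. eauto.
Qed.

End UncountableCofinality.

(** * From cleavability to a compatible well-order *)

Lemma cleavable_layering (X : Top) (x : X) (W : WellOrder) :
  compact X -> cleavable_over X W -> ~ is_open X (fun y => y = x) ->
  exists g, layering X x W g /\ exists d, d << g x.
Proof.
  intros cX cl nis.
  destruct (cl (fun y => y = x)) as [f0 [cf0 Hf0]].
  apply continuous_ray_continuous in cf0.
  assert (f0x : forall y, y <> x -> f0 y <> f0 x).
  { intros y n e. apply (Hf0 x y); auto. }
  (* Otherwise [x] would be the only point with value above [d] and at most [f0 x], making [{x}]
     open. *)
  assert (Hle : forall d, d << f0 x -> exists y, d << f0 y /\ f0 y << f0 x).
  { intros d Hd. apply NNPP; intros H. apply nis.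
    eapply open_ext; [|apply (open_inter X _ _ (proj2 (cf0 d))
      (ray_continuous_le X W f0 (f0 x) cf0))].
    intros y; simpl; split.
    - intros [H1 H2]. apply NNPP; intros n. apply H. exists y. split; auto.
      specialize (f0x y n). worder.
    - intros ->. split; auto. apply wo_irrefl. }
  assert (Hd0 : exists d, d << f0 x).
  { apply NNPP; intros H. apply nis.
    eapply open_ext; [|apply (ray_continuous_le X W f0 (f0 x) cf0)]. intros y; simpl; split.
    - intros H1. apply NNPP; intros n. apply H. exists (f0 y).
      specialize (f0x y n). worder.
    - intros ->. apply wo_irrefl. }
  destruct Hd0 as [d0 Hd0].
  (* Send the clopen set above [f0 x] to an arbitrary point [d0] below. *)
  destruct (choice_fun (fun y w => (~ f0 x << f0 y /\ w = f0 y) \/ (f0 x << f0 y /\ w = d0)))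
    as [f Hf].
  { intros y. destruct (classic (f0 x << f0 y)); eauto. }
  assert (fx : f x = f0 x).
  { destruct (Hf x) as [[_ h]|[h _]]; auto. destruct (wo_irrefl _ _ h). }
  assert (cf : ray_continuous X W f).
  { pose proof (ray_continuous_le X W f0 (f0 x) cf0) as ole.
    intros a; split.
    (* On the clopen upper part [f] is constantly [d0], so a ray contains all of it or none; hence
       the constant disjunct. *)
    - eapply open_ext; [|apply (open_or X _ _ (open_inter X _ _ ole (proj1 (cf0 a)))
        (open_inter X _ _ (proj2 (cf0 (f0 x)))
          (open_const_or X (d0 << a) _ (open_empty X))))].
      intros y; simpl. destruct (Hf y) as [[h ->]|[h ->]]; tauto.
    - eapply open_ext; [|apply (open_or X _ _ (open_inter X _ _ ole (proj2 (cf0 a)))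
        (open_inter X _ _ (proj2 (cf0 (f0 x)))
          (open_const_or X (a << d0) _ (open_empty X))))].
      intros y; simpl. destruct (Hf y) as [[h ->]|[h ->]]; tauto. }
  assert (f_max : forall y, y <> x -> f y << f x).
  { intros y n. rewrite fx. specialize (f0x y n).
    destruct (Hf y) as [[h ->]|[h ->]]; [worder|auto]. }
  assert (x_limit : forall d, d << f x -> exists y, y <> x /\ d << f y).
  { intros d Hd. rewrite fx in Hd. destruct (Hle d Hd) as [y [H1 H2]]. exists y. split.
    - intros ->. worder.
    - destruct (Hf y) as [[h ->]|[h _]]; [auto|worder]. }
  rewrite <- fx in Hd0.
  assert (H : exists g, layering X x W g /\ g x = f x).
  { destruct (classic (exists s : nat -> W, (forall n, s n << f x) /\
      forall d, d << f x -> exists n, d << s n)) as [[s [Hs1 Hs2]]|Hn].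
    - apply (cofinal_sequence_layering X x W f cf f_max s); auto.
    - apply bounded_sequences_layering; eauto.
      intros s Hs. apply NNPP; intros H. apply Hn. exists s. split; auto.
      intros d Hd. apply NNPP; intros H'. apply H. exists d. split; auto.
      intros n Hns. eauto. }
  destruct H as [g [Hg e]]. exists g. split; auto. exists d0. rewrite e. auto.
Qed.

Theorem theorem4p3 (X : Top) :
  infinite_space X -> compact X -> simple X -> cleavable_over_ordinal X ->
  homeomorphic_to_ordinal X.
Proof.
  intros _ cX sX [W cl].
  apply well_orderable_homeomorphic; auto.
  apply clopen_well_orderable; auto.
  { split; [apply open_full|]. eapply open_ext; [|apply open_empty]. simpl; tauto. }
  intros y _. apply NNPP; intros Hy.
  (* Pick an exceptional point isolated among the exceptional ones, so that all other points near it
     are locally well-orderable. *)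
  destruct (simple_scattered X (fun y => ~ locally_well_orderable X y) sX)
    as [x [Hx [U [oU [Ux HU]]]]]; [eauto|].
  apply Hx.
  destruct (classic (is_open X (fun y => y = x))) as [ox|nox].
  - destruct (cl (fun y => y = x)) as [f [cf Hf]]. apply continuous_ray_continuous in cf.
    exists (fun y => y = x). split; [split; auto|].
    + apply (open_ext X (fun y => f y << f x \/ f x << f y)).
      * intros z. split.
        -- intros [h|h] ->; exact (wo_irrefl _ _ h).
        -- intros n. assert (f x <> f z) by (apply Hf; auto).
           destruct (wo_total W (f z) (f x)) as [h|[h|h]]; auto. congruence.
      * apply open_or; apply cf.
    + split; auto. apply well_orderable_subsingleton. congruence.
  - destruct (cleavable_layering X x W cX cl nox) as [g [Hg Hd]].
    apply (layering_locally_well_orderable X x W g U); auto.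
    intros z Uz n. apply NNPP; intros Hz. auto.
Qed.
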